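(* Let $\mathcal{D}\subset\mathbb{R}^n$ be a polytope (the convex hull of a finite set of points), and let $\|\cdot\|=\sqrt{\langle\cdot,\cdot\rangle}$ be a norm on $\mathbb{R}^n$ induced by an inner product. Let $f:\mathbb{R}^n\to\mathbb{R}$ be convex and differentiable, and suppose that $f$ is $\mu$-strongly convex with respect to $\|\cdot\|$ over $\mathcal{D}$ with constant $\mu\ge0$, i.e. $f(y)-f(x)-\langle\nabla f(x),y-x\rangle\ge\frac{\mu}{2}\|y-x\|^2$ for all $x,y\in\mathcal{D}$. Then the geometric strong convexity constant $\mu_f^A$ of $f$ over $\mathcal{D}$ and the pyramidal width $\mathrm{PdirW}(\mathcal{D})$ of $\mathcal{D}$ (both defined in the context) satisfy $$\mu_f^A\ \ge\ \mu\cdot\big(\mathrm{PdirW}(\mathcal{D})\big)^2.$$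
   Context: Throughout, $\langle\cdot,\cdot\rangle$ is the inner product inducing $\|\cdot\|$, $\nabla f$ is the gradient with respect to it (so $\langle\nabla f(x),v\rangle$ is the directional derivative of $f$ at $x$ along $v$), and $\|\cdot\|_*$ is the dual norm, which under this identification equals $\|\cdot\|$. Let $\mathcal{V}$ be the set of vertices of $\mathcal{D}$. For $x\in\mathcal{D}$, let $\mathcal{S}_x$ be the collection of all sets $S\subseteq\mathcal{V}$ such that $x$ is a convex combination of all the elements of $S$ with all coefficients non-zero. Geometric strong convexity constant. Let $s_f(x)\in\arg\min_{v\in\mathcal{V}}\langle\nabla f(x),v\rangle$. For $S\in\mathcal{S}_x$ let $v_S(x)\in\arg\max_{v\in S}\langle\nabla f(x),v\rangle$, and let $v_f(x)\in\arg\min\{\langle\nabla f(x),v\rangle: v=v_S(x),\ S\in\mathcal{S}_x\}$. Define $$\mu_f^A:=\inf_{x\in\mathcal{D}}\ \inf_{\substack{z\in\mathcal{D}\\ \langle\nabla f(x),z-x\rangle<0}}\ \frac{2}{\gamma^A(x,z)^2}\big(f(z)-f(x)-\langle\nabla f(x),z-x\rangle\big),\qquad \gamma^A(x,z):=\frac{\langle\nabla f(x),z-x\rangle}{\langle\nabla f(x),s_f(x)-v_f(x)\rangle}.$$ Pyramidal width. The directional width of a set $A$ with respect to a direction $d\neq0$ is $\mathrm{dirW}(A,d):=\max_{x\in A}\langle\frac{d}{\|d\|_*},x\rangle-\min_{x\in A}\langle\frac{d}{\|d\|_*},x\rangle$. For a polytope $K$, a point $x\in K$ and a direction $d\ne0$,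 let $s(K,d)\in\arg\max_{v\in K}\langle d,v\rangle$ and $$\mathrm{PdirW}(K,d,x):=\min_{S\in\mathcal{S}_x}\mathrm{dirW}\big(S\cup\{s(K,d)\},d\big).$$ (For a face $K$ of $\mathcal{D}$ and $x\in K$, every $S\in\mathcal{S}_x$ consists of vertices of $K$, so $\mathcal{S}_x$ is the same whether computed in $K$ or in $\mathcal{D}$.) The pyramidal width of $\mathcal{D}$ is $$\mathrm{PdirW}(\mathcal{D}):=\inf\left\{\mathrm{PdirW}(K,d,x)\ :\ K\in\mathrm{faces}(\mathcal{D}),\ x\in K,\ d\in\mathrm{cone}(K-x)\setminus\{0\}\right\},$$ where $\mathcal{D}$ counts as a face of itself and $\mathrm{cone}(K-x)$ is the convex cone generated by $K-x$. Infima over empty sets are $+\infty$. *)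

(* Defs.v *)
(* MathComp-Analysis: R is an arbitrary realType, R^n is 'rV[R]_n. *)
From HB Require Import structures.
From mathcomp Require Import all_boot all_order all_algebra finmap.
From mathcomp Require Import all_classical all_reals all_analysis.
Set Implicit Arguments.
Unset Strict Implicit.
Unset Printing Implicit Defensive.
Import Order.TTheory GRing.Theory Num.Theory.
Import numFieldNormedType.Exports.
Local Open Scope classical_set_scope.
Local Open Scope ring_scope.

Section Polytopes.
Variables (R : realType) (n : nat).
Local Notation E := 'rV[R]_n.
Implicit Types (A D K : set E) (x v d : E).

Definition conv_hull A : set E :=
  [set x | exists (m : nat) (p : 'I_m -> E) (a : 'I_m -> R),
     [/\ forall i, A (p i), forall i, 0 <= a i,
         \sum_i a i = 1 & x = \sum_i a i *: p i]].

Definition cone_hull A : set E :=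
  [set x | exists (m : nat) (p : 'I_m -> E) (a : 'I_m -> R),
     [/\ forall i, A (p i), forall i, 0 <= a i & x = \sum_i a i *: p i]].

Definition polytope D := exists2 A, finite_set A & D = conv_hull A.

(* Only used for attained extrema; the values of g below do not depend on
   which extremal point is selected. *)
Definition argmin (g : E -> R) A : E :=
  [get v | A v /\ forall w, A w -> g v <= g w].
Definition argmax (g : E -> R) A : E :=
  [get v | A v /\ forall w, A w -> g w <= g v].

(* A positive definite symmetric bilinear form. *)
Variable ip : {dot E for idfun}.

Definition ipnorm v : R := Num.sqrt (ip v v).
Definition dual_norm d : R := sup [set ip d v | v in [set v | ipnorm v <= 1]].

(* K = D (take c = 0, b = 0) and K = set0 are faces. *)
Definition face D K :=
  exists (c : E) (b : R), (forall y, D y -> ip c y <= b) /\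
    K = D `&` [set y | ip c y = b].

Definition vertices D : set E := [set v | face D [set v]].

Definition active_sets D x : set {fset E} :=
  [set S : {fset E} | [set` S] `<=` vertices D /\
     exists a : E -> R, [/\ forall v, v \in S -> 0 < a v,
       \sum_(v <- S) a v = 1 & x = \sum_(v <- S) a v *: v]].

(* sup and inf are a maximum and a minimum on nonempty finite A. *)
Definition dirW A d : R :=
  let g v := ip ((dual_norm d)^-1 *: d) v in sup (g @` A) - inf (g @` A).

(* The minimum ranges over the finite family of active sets of x. They are
   computed in D; for a face K of D containing x they are those of K. *)
Definition pdirW_at D K d x : R :=
  inf [set dirW ([set` S] `|` [set argmax (ip d) K]) d | S in active_sets D x].

Definition pyramidal_width D : \bar R :=
  ereal_inf [set r | exists (K : set E) (x d : E),
    [/\ face D K, K x, cone_hull [set y - x | y in K] d, d != 0 &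
        r = (pdirW_at D K d x)%:E]].

Definition grad (f : E -> R) x : E := [get u | forall v, ip u v = 'd f x v].

Definition strongly_convex_on (f : E -> R) (mu : R) D :=
  forall x y, D x -> D y ->
    mu / 2 * ipnorm (y - x) ^+ 2 <= f y - f x - ip (grad f x) (y - x).

Definition s_f f D x : E := argmin (ip (grad f x)) (vertices D).
Definition v_S f (S : {fset E}) x : E := argmax (ip (grad f x)) [set` S].
Definition v_f f D x : E :=
  argmin (ip (grad f x)) [set v_S f S x | S in active_sets D x].

Definition gammaA f D x z : R :=
  ip (grad f x) (z - x) / ip (grad f x) (s_f f D x - v_f f D x).

Definition muA (f : E -> R) D : \bar R :=
  ereal_inf [set
    ereal_inf [set (2 / gammaA f D x z ^+ 2 *
                     (f z - f x - ip (grad f x) (z - x)))%:E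
              | z in [set z | D z /\ ip (grad f x) (z - x) < 0]]
  | x in D].

End Polytopes.

(* Main.v *)
Require Import Defs.
From HB Require Import structures.
From mathcomp Require Import all_boot all_order all_algebra finmap.
From mathcomp Require Import all_classical all_reals all_analysis.
From mathcomp Require Import ring lra.
(** Fix x and z in D with <r, z - x> > 0, where r is minus the gradient of f
at x, and write e = z - x.  Let d be the orthogonal projection of r onto the
cone generated by D - x.  Then r - d is nonpositive on D - x and orthogonal
to d.  Two consequences carry the proof.
- <r, e> <= <d, e> <= |d| |e|, so d is nonzero and is at least as good a
  direction as r.
- The points of D where r - d attains its maximum <r - d, x> form a face K
  containing x, and since <r - d, d> = 0 every generator y - x that
  contributes to d has y in K.  So (K, x, d) is one of the triples over which
  the pyramidal width is an infimum.
On K the forms <r, .> and <d, .> differ by a constant, and every active set of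
x lies in K.  Hence PdirW (K, d, x) <= <r, s_f - v_f> / |d|
([pyramidal_width_le]), and therefore
  PdirW (D) * <r, e> <= PdirW (D) * |d| |e| <= |e| <r, s_f - v_f>,
that is PdirW (D) <= |e| / gammaA.  Strong convexity bounds the numerator in
the definition of muA below by mu / 2 * |e| ^ 2, which gives the inequality.

Projections onto finitely generated cones ([cone_projection]) are obtained by
induction on the number of generators, without any topology.  They also
yield a strict separation theorem ([strict_separation]), from which a
polytope is the convex hull of its finitely many vertices
([polytope_vertices]).  This is what makes s_f and v_f genuine extrema: the
linear form attains its minimum over D at a vertex, and every point of D has
an active set. *)

Set Implicit Arguments.
Unset Strict Implicit.
Unset Printing Implicit Defensive.
Import Order.TTheory GRing.Theory Num.Theory.
Import numFieldNormedType.Exports.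
Local Open Scope classical_set_scope.
Local Open Scope ring_scope.

(** * Extrema over finite sets *)

Lemma seq_minimum (R : realDomainType) (T : eqType) (g : T -> R) (A : set T)
    (s : seq T) :
  A `<=` [set` s] -> A !=set0 -> exists v, A v /\ forall w, A w -> g v <= g w.
Proof.
suff min_s w0 : A w0 -> exists v, A v /\ forall w, w \in w0 :: s -> A w -> g v <= g w.
  move=> As [w0 Aw0]; have [v [Av vP]] := min_s _ Aw0.
  by exists v; split=> // w Aw; apply: vP => //; rewrite inE orbC As.
move=> Aw0; elim: s => [|u s [v [Av vP]]].
  by exists w0; split=> // w; rewrite inE => /eqP ->.
have [[Au uv]|Nuv] := pselect (A u /\ g u <= g v).
  exists u; split=> // w; rewrite !inE => /or3P[/eqP ->|/eqP ->//|ws] Aw.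
    by rewrite (le_trans uv) // vP // mem_head.
  by rewrite (le_trans uv) // vP // inE ws orbT.
exists v; split=> // w; rewrite !inE => /or3P[/eqP -> _|/eqP -> Au|ws Aw].
- by rewrite vP // mem_head.
- by rewrite leNgt; apply/negP => /ltW uv; apply: Nuv.
- by rewrite vP // inE ws orbT.
Qed.

Lemma seq_maximum (R : realDomainType) (T : eqType) (g : T -> R) (A : set T)
    (s : seq T) :
  A `<=` [set` s] -> A !=set0 -> exists v, A v /\ forall w, A w -> g w <= g v.
Proof.
move=> As /(seq_minimum (fun v => - g v) As)[v [Av vP]].
by exists v; split=> // w /vP; rewrite lerN2.
Qed.

(** * Inner products *)

Section InnerProduct.
Variables (R : realType) (n : nat) (ip : {dot 'rV[R]_n for idfun}).
Local Notation E := 'rV[R]_n.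
Implicit Types (u v w c d r x y : E).

Lemma ipC u v : ip u v = ip v u.
Proof. by rewrite hermC /= expr0 mul1r. Qed.

Lemma ipDr w u v : ip w (u + v) = ip w u + ip w v.
Proof. exact: linearDr. Qed.

Lemma ipBr w u v : ip w (u - v) = ip w u - ip w v.
Proof. exact: linearBr. Qed.

Lemma ipBl w u v : ip (u - v) w = ip u w - ip v w.
Proof. exact: linearBl. Qed.

Lemma ipZl w a u : ip (a *: u) w = a * ip u w.
Proof. exact: linearZl_LR. Qed.

Lemma ipZr w a u : ip w (a *: u) = a * ip w u.
Proof. exact: linearZr_LR. Qed.

Lemma ip_gt0 u : u != 0 -> 0 < ip u u.
Proof. exact: neq0_dnorm_gt0. Qed.

Lemma ip_ge0 u : 0 <= ip u u.
Proof. by have [->|/ip_gt0/ltW//] := eqVneq u 0; rewrite linear0r. Qed.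

Lemma ip_comb (I : Type) (s : seq I) (P : pred I) c (a : I -> R) (p : I -> E) :
  ip c (\sum_(i <- s | P i) a i *: p i) = \sum_(i <- s | P i) a i * ip c (p i).
Proof. by rewrite linear_sumr; apply: eq_bigr => i _; exact: ipZr. Qed.

Lemma ip_comb_le0 m (a : 'I_m -> R) (p : 'I_m -> E) c :
  (forall i, 0 <= a i) -> (forall i, ip c (p i) <= 0) ->
  ip c (\sum_i a i *: p i) <= 0.
Proof.
move=> a0 h; rewrite ip_comb; apply: sumr_le0 => i _.
by rewrite mulr_ge0_le0.
Qed.

(** * Projection onto a finitely generated cone and separation *)

(** The vector p is the point of cone (b) nearest to r, characterised by its
Kuhn-Tucker conditions.  Induct on the number of generators.  Let p be the
projection on the cone C of all generators but b0.  If r - p has no positive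
component along b0, then p is still optimal.  Otherwise project on the larger
cone C + R b0, which amounts to a projection in the orthogonal complement of
b0 on the images of the other generators.  The coefficient t of b0 in the
result q must be nonnegative: if t < 0, expanding <p - q, p - q> with the
conditions satisfied by p and by q makes it negative. *)
Lemma cone_projection m (b : 'I_m -> E) r :
  exists (a : 'I_m -> R) (p : E),
    [/\ forall i, 0 <= a i, p = \sum_i a i *: b i,
        forall i, ip (r - p) (b i) <= 0 & ip (r - p) p = 0].
Proof.
elim: m b r => [|m IH] b r.
  exists (fun=> 0), 0; split=> [//||[]//|]; last by rewrite linear0r.
  by rewrite big_ord0.
set b0 := b ord0; pose B i := b (lift ord0 i).
have [a [p [a0 pE pB pp]]] := IH B r.
have [pb0|pb0] := leP (ip (r - p) b0) 0.
  exists (fun i => oapp a 0 (unlift ord0 i)), p; split=> //.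
  - by move=> i; case: unliftP => /=.
  - rewrite big_ord_recl unlift_none /= scale0r add0r pE.
    by apply: eq_bigr => i _; rewrite liftK.
  - by move=> i; case: (unliftP ord0 i) => [j|] ->; [exact: pB|].
have b0N : b0 != 0.
  by apply: contraTneq pb0 => ->; rewrite linear0r ltxx.
have N0 := ip_gt0 b0N; set N := ip b0 b0 in N0.
pose pi u : E := u - (ip u b0 / N) *: b0.
have pib0 u : ip (pi u) b0 = 0.
  by rewrite ipBl ipZl -/N divfK ?subrr ?gt_eqF.
have pi_orth w u : ip w b0 = 0 -> ip w (pi u) = ip w u.
  by move=> h; rewrite ipBr ipZr h mulr0 subr0.
have [a' [p' [a'0 p'E p'B p'p]]] := IH (pi \o B) (pi r).
pose Q := \sum_i a' i *: B i.
have p'Q : p' = pi Q.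
  rewrite p'E /pi /Q linear_sumlz mulr_suml scaler_suml -sumrB.
  apply: eq_bigr => i _ /=.
  by rewrite scalerBr ipZl scalerA mulrA.
(* This value of t makes r - q orthogonal to b0. *)
pose t := ip (r - Q) b0 / N; pose q := Q + t *: b0.
have rq : r - q = pi r - p'.
  rewrite p'Q /q /pi /t ipBl mulrBl scalerBl.
  set x := _ *: b0; set y := _ *: b0.
  by rewrite opprD !opprB addrA (addrC y (- Q)) [RHS]addrACA (addrC (- x)).
have qb0 : ip (r - q) b0 = 0 by rewrite rq p'Q ipBl !pib0 subr0.
have qB i : ip (r - q) (B i) <= 0 by rewrite -(pi_orth _ _ qb0) rq p'B.
have qQ : ip (r - q) Q = 0 by rewrite -(pi_orth _ _ qb0) rq -p'Q p'p.
have qq : ip (r - q) q = 0 by rewrite ipDr ipZr qb0 qQ mulr0 addr0.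
have t0 : 0 <= t.
  rewrite leNgt; apply/negP => t0.
  have h1 : ip (r - q) p <= 0 by rewrite pE; exact: ip_comb_le0.
  have h2 : ip (r - p) Q <= 0 by exact: ip_comb_le0.
  have h3 : ip (r - p) q = ip (r - p) Q + t * ip (r - p) b0.
    by rewrite ipDr ipZr.
  have h4 : t * ip (r - p) b0 < 0 by rewrite nmulr_rlt0.
  have := ip_ge0 (p - q).
  have {1}-> : p - q = (r - q) - (r - p).
    by rewrite opprB [RHS]addrC addrA subrK.
  rewrite ipBl !ipBr; lra.
exists (fun i => oapp a' t (unlift ord0 i)), q; split=> //.
- by move=> i; case: unliftP => /=.
- rewrite big_ord_recl unlift_none /= /q addrC; congr (_ + _).
  by apply: eq_bigr => i _; rewrite liftK.
- by move=> i; case: (unliftP ord0 i) => [j|] ->; [exact: qB|rewrite qb0].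
Qed.

(** Translate v to the origin and put w i = b i - v.  For each j, project
- w j on the cone of the w i.  The residual c j is nonpositive on every w i,
and it is negative on w j unless it vanishes; if it vanished, w j plus a
nonnegative combination of the w i would be zero, and normalising the
weights would put v in the convex hull.  The sum of the c j separates
strictly. *)
Lemma strict_separation m (b : 'I_m -> E) v :
  ~ conv_hull (range b) v -> exists c, forall i, ip c (b i) < ip c v.
Proof.
move=> Nv; pose w i := b i - v.
have /choice[c cP] j : exists c,
    (forall i, ip c (w i) <= 0) /\ ip c (w j) < 0.
  have [a [p [a0 pE pw pp]]] := cone_projection w (- w j).
  exists (- w j - p); split=> //.
  have [c0|/ip_gt0] := eqVneq (- w j - p) 0; last first.
    rewrite ipBr pp linearNr; lra.
  case: Nv; pose a' i := (i == j)%:R + a i.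
  have a'0 i : 0 <= a' i by rewrite addr_ge0.
  have T0 : 0 < \sum_i a' i.
    rewrite (bigD1 j) //= ltr_wpDr ?sumr_ge0//.
    by rewrite /a' eqxx ltr_wpDr.
  exists m, b, (fun i => a' i / \sum_i a' i); split.
  - by move=> i; exists i.
  - by move=> i; rewrite divr_ge0// ltW.
  - by rewrite -mulr_suml divff// gt_eqF.
  have wa : \sum_i a' i *: w i = 0.
    under eq_bigr do rewrite scalerDl.
    rewrite big_split /= -pE (bigD1 j) //= eqxx scale1r big1 ?addr0; last first.
      by move=> i /negbTE ->; rewrite scale0r.
    by apply: oppr_inj; rewrite oppr0 opprD.
  have bT : \sum_i a' i *: b i = (\sum_i a' i) *: v.
    apply/eqP; rewrite -subr_eq0 scaler_suml -sumrB -[X in _ == X]wa.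
    by apply/eqP/eq_bigr => i _; rewrite scalerBr.
  under eq_bigr do rewrite mulrC -scalerA.
  by rewrite -scaler_sumr bT scalerA mulVf ?scale1r ?gt_eqF.
exists (\sum_j c j) => i.
rewrite -subr_lt0 -ipBr linear_sumlz (bigD1 i) //=.
have [_ h] := cP i.
by rewrite ltr_wnDr // sumr_le0 // => j _; exact: (cP j).1.
Qed.

(** * Convex hulls and vertices *)

(** The defects b - <c, p i> are nonnegative and their weighted average is
zero. *)
Lemma tight_weights (I : eqType) (s : seq I) (a : I -> R) (p : I -> E) c b :
  {in s, forall i, 0 <= a i} -> \sum_(i <- s) a i = 1 ->
  {in s, forall i, ip c (p i) <= b} ->
  ip c (\sum_(i <- s) a i *: p i) = b ->
  {in s, forall i, a i != 0 -> ip c (p i) = b}.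
Proof.
move=> a0 a1 pb; rewrite ip_comb => cb i si ai.
have : \sum_(j <- s | j \in s) a j * (b - ip c (p j)) == 0.
  rewrite -big_seq; under eq_bigr do rewrite mulrBr.
  by rewrite sumrB -mulr_suml a1 mul1r cb subrr.
rewrite psumr_eq0 => [/allP/(_ _ si)|j sj]; last first.
  by rewrite mulr_ge0 ?a0 // subr_ge0 pb.
by rewrite si /= mulf_eq0 (negbTE ai) /= subr_eq0 => /eqP.
Qed.

Lemma conv_hull_ip_le (A : set E) c b y :
  (forall w, A w -> ip c w <= b) -> conv_hull A y -> ip c y <= b.
Proof.
move=> Ab [m [p [a [Ap a0 a1 ->]]]]; rewrite ip_comb -[b]mul1r -a1 mulr_suml.
by apply: ler_sum => i _; rewrite ler_wpM2l // Ab.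
Qed.

(** By [tight_weights], only generators on the supporting hyperplane carry
weight in y. *)
Lemma conv_hull_face (A : set E) c b y :
  (forall w, A w -> ip c w <= b) -> conv_hull A y -> ip c y = b ->
  conv_hull (A `&` [set w | ip c w = b]) y.
Proof.
move=> Ab [m [p [a [Ap a0 a1 ->]]]] yb.
have tight i : a i != 0 -> ip c (p i) = b.
  move=> ai; apply: (tight_weights (a := a)) (mem_index_enum i) ai => //.
  by move=> j _; exact: Ab.
have [i0 /= /lt0r_neq0 ai0] : exists i, predT i && (0 < a i).
  by apply: psumr_neq0P => //; rewrite a1; exact/eqP/oner_neq0.
(* Points of weight zero may lie off the hyperplane: p i0 replaces them. *)
exists m, (fun i => if a i == 0 then p i0 else p i), a; split=> //.
  by move=> i; case: ifPn => ai; split; rewrite /= ?tight //; exact: Ap.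
by apply: eq_bigr => i _; case: ifPn => // /eqP ->; rewrite !scale0r.
Qed.

Lemma sub_conv_hull (A : set E) : A `<=` conv_hull A.
Proof.
move=> x Ax; exists 1, (fun=> x), (fun=> 1); split=> //.
  by rewrite big_ord1.
by rewrite big_ord1 scale1r.
Qed.

Lemma conv_hull_nonempty (A : set E) x : conv_hull A x -> A !=set0.
Proof.
move=> [[|m] [p [a [Ap _ a1 _]]]]; last by exists (p ord0).
by move/eqP: a1; rewrite big_ord0 eq_sym oner_eq0.
Qed.

Lemma conv_hull_sub1 (A : set E) v x :
  A `<=` [set v] -> conv_hull A x -> x = v.
Proof.
move=> Av [m [p [a [Ap _ a1 ->]]]].
under eq_bigr => i _ do rewrite (Av _ (Ap i)).
by rewrite -scaler_suml a1 scale1r.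
Qed.

(** Indexing the weights by the points themselves merges repeated points;
this form is the one in which weights can be added. *)
Lemma conv_hull_seqP (s : seq E) x : uniq s ->
  conv_hull [set` s] x <-> exists a : E -> R,
    [/\ forall v, 0 <= a v, \sum_(v <- s) a v = 1 &
        x = \sum_(v <- s) a v *: v].
Proof.
move=> us; split=> [[m [p [a [Ap a0 a1 ->]]]]|[a [a0 a1 ->]]]; last first.
  exists (size s), (fun i => s`_i), (fun i => a s`_i); split=> //.
  - by move=> i; exact: mem_nth.
  - by rewrite -a1 (big_nth 0) big_mkord.
  - by rewrite (big_nth 0) big_mkord.
have pick1 (V : nmodType) (F : 'I_m -> V) :
    \sum_(v <- s) \sum_(i | p i == v) F i = \sum_i F i.
  under eq_bigr do rewrite big_mkcond; rewrite exchange_big /=.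
  apply: eq_bigr => i _; rewrite (bigD1_seq (p i)) //= ?eqxx; last exact: Ap.
  by rewrite big1 ?addr0 // => v; rewrite eq_sym => /negbTE ->.
exists (fun v => \sum_(i | p i == v) a i); split.
- by move=> v; exact: sumr_ge0.
- by rewrite pick1.
- rewrite -pick1; apply: eq_bigr => v _; rewrite scaler_suml.
  by apply: eq_bigr => i /eqP ->.
Qed.

(** A generator that is a combination of the others can be substituted away:
this lets a generating list be shrunk until it is irredundant. *)
Lemma conv_hull_rem (s : seq E) v : uniq s -> v \in s ->
  conv_hull [set` rem v s] v -> conv_hull [set` s] = conv_hull [set` rem v s].
Proof.
move=> us sv; have ur := rem_uniq v us.
have ps := perm_to_rem sv.
move=> /(conv_hull_seqP _ ur)[c [c0 c1 vE]].
apply/seteqP; split=> x; last first.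
  by move=> [m [p [a [Ap a0 a1 ->]]]]; exists m, p, a; split=> // i;
    exact: mem_rem (Ap i).
move=> /(conv_hull_seqP _ us)[a [a0 + ->]].
rewrite !(perm_big _ ps) !big_cons /= => a1; apply/(conv_hull_seqP _ ur).
exists (fun w => a v * c w + a w); split.
- by move=> w; rewrite addr_ge0 ?mulr_ge0.
- by rewrite big_split /= -mulr_sumr c1 mulr1.
- rewrite {2}vE scaler_sumr -big_split /=; apply: eq_bigr => w _.
  by rewrite scalerDl scalerA.
Qed.

Lemma vertices_sub_gen (A : set E) : vertices ip (conv_hull A) `<=` A.
Proof.
move=> v [c [b [cb vE]]].
have [Dv /= cv] : (conv_hull A `&` [set y | ip c y = b]) v by rewrite -vE.
have Ab w : A w -> ip c w <= b by move=> /sub_conv_hull; exact: cb.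
have [w [Aw /= cw]] := conv_hull_nonempty (conv_hull_face Ab Dv cv).
suff <- : w = v by [].
by have : [set v] w by rewrite vE; split=> //; exact: sub_conv_hull.
Qed.

(** A form that separates v strictly from the other generators is maximal
over the hull at v only, so it exhibits {v} as a face. *)
Lemma irredundant_vertex (s : seq E) v : uniq s -> v \in s ->
  ~ conv_hull [set` rem v s] v -> vertices ip (conv_hull [set` s]) v.
Proof.
move=> us sv Nv.
have [c cP] : exists c, forall w, w \in rem v s -> ip c w < ip c v.
  have [|c cP] := @strict_separation (size (rem v s)) (fun i => (rem v s)`_i) v.
    apply: contra_not Nv => -[m [p [a [Ap a0 a1 vE]]]].
    by exists m, p, a; split=> // i; have [j _ <-] := Ap i; exact: mem_nth.
  exists c => w ws; move: (ws); rewrite -index_mem => lt_ws.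
  by have := cP (Ordinal lt_ws); rewrite /= nth_index.
have cs w : [set` s] w -> ip c w <= ip c v.
  move=> /= ws; have [->//|wv] := eqVneq w v.
  by rewrite ltW // cP // (mem_rem_uniq _ us) inE wv.
exists c, (ip c v); split=> [y|]; first exact: conv_hull_ip_le.
apply/seteqP; split=> [_ ->|y [Dy /= cy]]; first by split=> //; exact: sub_conv_hull.
apply: conv_hull_sub1 (conv_hull_face cs Dy cy) => w [/= ws cw].
apply/eqP; apply: contra_eqT cw => wv.
by rewrite lt_eqF // cP // (mem_rem_uniq _ us) inE wv.
Qed.

(** Discard redundant generators one at a time; those of an irredundant list
are all vertices, and no other point can be one by [vertices_sub_gen]. *)
Lemma polytope_vertices (D : set E) : polytope D -> exists s : seq E,
  [/\ uniq s, D = conv_hull [set` s] & vertices ip D = [set` s]].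
Proof.
move=> [A /finite_seqP[s0 ->] ->].
have -> : [set` s0] = [set` undup s0].
  by apply/seteqP; split=> x /=; rewrite mem_undup.
move: (undup s0) (undup_uniq s0) => s; have [k] := ubnP (size s).
elim: k s => // k IH s sk us.
have [[v [sv Dv]]|irr] := pselect (exists v, v \in s /\ conv_hull [set` rem v s] v).
  rewrite (conv_hull_rem us sv Dv); apply: IH; last exact: rem_uniq.
  rewrite size_rem //; apply: leq_trans (ltnSE sk).
  by case: s sv {sk us Dv}.
exists s; split=> //; apply/seteqP; split=> [|v sv]; first exact: vertices_sub_gen.
by apply: irredundant_vertex => // Dv; apply: irr; exists v.
Qed.


Lemma argminP (g : E -> R) (A : set E) (s : seq E) :
  A `<=` [set` s] -> A !=set0 ->
  A (argmin g A) /\ forall w, A w -> g (argmin g A) <= g w.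
Proof. by move=> As /(seq_minimum g As); exact: getPex. Qed.

Lemma argmaxP (g : E -> R) (A : set E) :
  (exists v, A v /\ forall w, A w -> g w <= g v) ->
  A (argmax g A) /\ forall w, A w -> g w <= g (argmax g A).
Proof. exact: getPex. Qed.

(** * The norm and the directional width *)

Lemma ipnorm_ge0 u : 0 <= ipnorm ip u.
Proof. exact: sqrtr_ge0. Qed.

Lemma sqr_ipnorm u : ipnorm ip u ^+ 2 = ip u u.
Proof. by rewrite sqr_sqrtr // ip_ge0. Qed.

Lemma ipnorm_gt0 u : u != 0 -> 0 < ipnorm ip u.
Proof. by move=> u0; rewrite sqrtr_gt0 ip_gt0. Qed.

Lemma ip_CauchySchwarz u v : ip u v <= ipnorm ip u * ipnorm ip v.
Proof.
have [->|/ipnorm_gt0 u0] := eqVneq u 0.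
  by rewrite linear0l mulr_ge0 ?ipnorm_ge0.
have [->|/ipnorm_gt0 v0] := eqVneq v 0.
  by rewrite linear0r mulr_ge0 ?ipnorm_ge0.
have := ip_ge0 (ipnorm ip v *: u - ipnorm ip u *: v).
rewrite !(ipBl, ipBr, ipZl, ipZr) -!sqr_ipnorm (ipC v u).
move: u0 v0; set a := ipnorm ip u; set b := ipnorm ip v => a0 b0 h.
rewrite -(ler_pM2l (mulr_gt0 a0 b0)); nra.
Qed.

Lemma dual_normE d : dual_norm ip d = ipnorm ip d.
Proof.
have ub : ubound [set ip d v | v in [set v | ipnorm ip v <= 1]] (ipnorm ip d).
  move=> _ [v /= v1 <-]; apply: le_trans (ip_CauchySchwarz d v) _.
  by rewrite ler_piMr // ipnorm_ge0.
apply/le_anti/andP; split.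
  apply: ge_sup => //; exists (ip d 0), 0 => //=.
  by rewrite /ipnorm linear0r sqrtr0.
apply: ub_le_sup; first by exists (ipnorm ip d).
have [->|d0] := eqVneq d 0.
  by exists 0; rewrite /ipnorm /= linear0r sqrtr0.
have nd := ipnorm_gt0 d0; exists ((ipnorm ip d)^-1 *: d) => /=.
  rewrite {1}/ipnorm ipZl ipZr -sqr_ipnorm expr2 mulKf ?gt_eqF // mulVf ?gt_eqF //.
  by rewrite sqrtr1.
by rewrite ipZr -sqr_ipnorm expr2 mulKf // gt_eqF.
Qed.

Lemma dirW_ge0 (A : set E) (s : seq E) d :
  A `<=` [set` s] -> A !=set0 -> 0 <= dirW ip A d.
Proof.
move=> As A0; rewrite /dirW subr_ge0.
set g := fun v => _.
have [u [Au uP]] := seq_minimum g As A0.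
have [w [Aw wP]] := seq_maximum g As A0.
apply: (@le_trans _ _ (g u)).
  by apply: ge_inf; [exists (g u) => _ [y Ay <-]; exact: uP|exists u].
by apply: ub_le_sup; [exists (g w) => _ [y Ay <-]; exact: wP|exists u].
Qed.

Lemma dirW_le (A : set E) d m M : A !=set0 ->
  (forall w, A w -> m <= ip d w <= M) -> dirW ip A d <= (M - m) / ipnorm ip d.
Proof.
move=> [a Aa] mM; rewrite /dirW dual_normE mulrC mulrBr.
have n0 : 0 <= (ipnorm ip d)^-1 by rewrite invr_ge0 ipnorm_ge0.
apply: lerB.
  apply: ge_sup; first by exists (ip ((ipnorm ip d)^-1 *: d) a), a.
  move=> _ [w /mM/andP[_ wM] <-]; rewrite ipZl; exact: ler_wpM2l.
apply: lb_le_inf; first by exists (ip ((ipnorm ip d)^-1 *: d) a), a.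
move=> _ [w /mM/andP[mw _] <-]; rewrite ipZl; exact: ler_wpM2l.
Qed.

(** * Active sets *)

Lemma vertices_sub (D : set E) : vertices ip D `<=` D.
Proof.
move=> v [c [b [_ vE]]].
by have [Dv _] : (D `&` [set y | ip c y = b]) v by rewrite -vE.
Qed.

(** All coefficients in an active set of x are positive, so every face
containing x contains the whole active set. *)
Lemma active_sets_face (D : set E) x S c b :
  active_sets ip D x S -> (forall y, D y -> ip c y <= b) -> ip c x = b ->
  forall v, v \in S -> D v /\ ip c v = b.
Proof.
move=> [Sv [a [a0 a1 xE]]] cb cx v vS.
have SD w : w \in S -> D w.
  by move=> wS; apply: vertices_sub; exact: Sv.
split; first exact: SD.
apply: (tight_weights (a := a) (p := id) _ a1 _ _ vS).
- by move=> w /a0/ltW.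
- by move=> w /SD/cb.
- by rewrite -xE.
- by rewrite gt_eqF // a0.
Qed.

Lemma active_sets_nonempty (s : seq E) x : uniq s ->
  vertices ip (conv_hull [set` s]) = [set` s] -> conv_hull [set` s] x ->
  active_sets ip (conv_hull [set` s]) x !=set0.
Proof.
move=> us vE /(conv_hull_seqP _ us)[a [a0 a1 xE]].
pose S := [fset v in s | 0 < a v]%fset.
have bigS (V : nmodType) (F : E -> V) : (forall v, a v = 0 -> F v = 0) ->
    \sum_(v <- S) F v = \sum_(v <- s) F v.
  move=> F0; rewrite (perm_big [seq v <- s | 0 < a v]) /=; last first.
    apply: uniq_perm; rewrite ?fset_uniq ?filter_uniq // => v.
    by rewrite mem_filter !inE /= andbC.
  rewrite big_filter big_mkcond; apply: eq_bigr => v _.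
  by have [//|av] := ltP; rewrite F0 //; apply/le_anti; rewrite av a0.
exists S; split=> [v|]; first by rewrite vE /= !inE => /andP[].
exists a; split.
- by move=> v; rewrite !inE => /andP[].
- by rewrite bigS.
- by rewrite bigS // => v ->; rewrite scale0r.
Qed.

(** * The pyramidal width bounds the slope *)

(** Here d is the projection of r on the cone of the generators minus x.
Since <r - d, d> = 0 while r - d is nonpositive on each generator, the
generators that contribute to d lie on the face where r - d is maximal;
this puts d in the cone of that face. *)
Lemma cone_projection_face (s : seq E) x r : conv_hull [set` s] x ->
  exists d, (forall y, conv_hull [set` s] y -> ip (r - d) y <= ip (r - d) x) /\
    cone_hull [set y - x | y in
      conv_hull [set` s] `&` [set y | ip (r - d) y = ip (r - d) x]] d.
Proof.
move=> Dx; pose b (i : 'I_(size s)) := s`_i - x.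
have [a [d [a0 dE db dd]]] := cone_projection b r.
have Db (i : 'I_(size s)) : conv_hull [set` s] (s`_i).
  by apply: sub_conv_hull; exact: mem_nth.
exists d; split.
  move=> y; apply: conv_hull_ip_le => w ws.
  move: (ws); rewrite /= -index_mem => lt_ws.
  have := db (Ordinal lt_ws); rewrite /b /= nth_index // ipBr; lra.
have tight i : a i != 0 -> ip (r - d) (b i) = 0.
  move=> ai; have : ip (r - d) d == 0 by rewrite dd.
  rewrite {2}dE ip_comb -oppr_eq0 -sumrN psumr_eq0; last first.
    by move=> j _; rewrite -mulrN mulr_ge0 // oppr_ge0.
  move=> /allP/(_ i (mem_index_enum i)) /=.
  by rewrite oppr_eq0 mulf_eq0 (negbTE ai) => /eqP.
(* Generators outside the face have weight zero; 0 = x - x replaces them. *)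
exists (size s), (fun i => if a i == 0 then 0 else b i), a; split=> //.
  move=> i; case: ifPn => ai; first by exists x; rewrite ?subrr.
  exists s`_i => //; split=> //=.
  by apply/eqP; rewrite -subr_eq0 -ipBr; apply/eqP/tight.
by rewrite {1}dE; apply: eq_bigr => i _; case: ifPn => // /eqP->; rewrite !scale0r.
Qed.

Lemma pdirW_at_ge0 D K d x : 0 <= pdirW_at ip D K d x.
Proof.
rewrite /pdirW_at; have [->|/set0P[t At]] := eqVneq (active_sets ip D x) set0.
  by rewrite image_set0 inf0.
apply: lb_le_inf; first by exists (dirW ip ([set` t] `|` [set argmax (ip d) K]) d), t.
move=> _ [S _ <-]; apply: (dirW_ge0 (s := argmax (ip d) K :: S)).
  by move=> v [/= vS|/= ->]; rewrite inE ?eqxx ?vS ?orbT.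
by exists (argmax (ip d) K); right.
Qed.

(** The slope <r, z - x> / |z - x| times the width is at most the pairwise gap
<r, sr - v>.  The width is tested at the face K and at the projected direction
d of [cone_projection_face].  The hypothesis that some z gives a positive
slope is also what makes the width finite. *)
Lemma pyramidal_width_le (s : seq E) x z r sr v (S : {fset E}) :
  let D := conv_hull [set` s] in
  D x -> D z -> 0 < ip r (z - x) ->
  (forall y, D y -> ip r y <= ip r sr) ->
  active_sets ip D x S -> v \in S -> (forall w, w \in S -> ip r v <= ip r w) ->
  exists2 P : R, pyramidal_width ip D = P%:E &
    0 <= P /\ P * ip r (z - x) <= ipnorm ip (z - x) * ip r (sr - v).
Proof.
move=> D Dx Dz rz srP AS vS vP.
have [d [rdx coned]] := cone_projection_face r Dx.
set K := D `&` _ in coned.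
have Kx : K x by [].
have rd_le : ip r (z - x) <= ip d (z - x).
  have := rdx _ Dz; rewrite !ipBr !ipBl; lra.
have d0 : d != 0.
  by apply: contraTneq rd_le => ->; rewrite linear0l -ltNge.
have nd := ipnorm_gt0 d0.
have ge0 : (0 <= pyramidal_width ip D)%E.
  by apply: le_ereal_inf_tmp => _ [? [? [? [_ _ _ _ ->]]]]; rewrite lee_fin pdirW_at_ge0.
have leK : (pyramidal_width ip D <= (pdirW_at ip D K d x)%:E)%E.
  apply: ereal_inf_lbound; exists K, x, d; split=> //.
  by exists (r - d), (ip (r - d) x).
have Pfin : pyramidal_width ip D \is a fin_num.
  by rewrite ge0_fin_numE // (le_lt_trans leK) ?ltry.
exists (fine (pyramidal_width ip D)); first by rewrite fineK.
split; first exact: fine_ge0.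
(* On K the forms of r and d differ by a constant. *)
have Kvx y : K y -> ip r y = ip d y + ip (r - d) x.
  by move=> [_ /= <-]; rewrite ipBl addrC subrK.
have SK w : w \in S -> K w by exact: (active_sets_face AS rdx erefl).
have gen_le w : [set` s] w -> ip (r - d) w <= ip (r - d) x.
  by move=> /sub_conv_hull; exact: rdx.
have KE y : K y -> conv_hull ([set` s] `&` [set y | ip (r - d) y = ip (r - d) x]) y.
  by move=> [Dy]; exact: conv_hull_face.
have [|Ksd sdP] := @argmaxP (ip d) K.
  have [] := @seq_maximum _ _ (ip d) _ s (@subIsetl _ _ _) (conv_hull_nonempty (KE _ Kx)).
  move=> w [[ws wx] wP]; exists w; split; first by split=> //; exact: sub_conv_hull.
  by move=> y /KE; exact: conv_hull_ip_le.
set sd := argmax _ _ in Ksd sdP.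
have leW : pdirW_at ip D K d x <= ip r (sr - v) / ipnorm ip d.
  apply: (@le_trans _ _ (dirW ip ([set` S] `|` [set sd]) d)).
    apply: ge_inf; last by exists S.
    exists 0 => _ [T _ <-]; apply: (dirW_ge0 (s := sd :: T)).
      by move=> w [/= wT|/= ->]; rewrite inE ?eqxx ?wT ?orbT.
    by exists sd; right.
  apply: (@le_trans _ _ ((ip d sd - ip d v) / ipnorm ip d)).
    apply: dirW_le; first by exists sd; right.
    have vsd w : w \in S -> ip d v <= ip d w.
      by move=> wS; have := vP _ wS; rewrite !Kvx ?lerD2r //; exact: SK.
    move=> w [/= wS|/= ->]; first by rewrite vsd // sdP //; exact: SK.
    by rewrite lexx sdP //; exact: SK.
  rewrite ler_pM2r ?invr_gt0 // ipBr.
  have := srP _ Ksd.1; rewrite (Kvx _ Ksd) (Kvx _ (SK _ vS)); lra.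
have P0 : 0 <= fine (pyramidal_width ip D) by exact: fine_ge0.
have : fine (pyramidal_width ip D) * ipnorm ip d <= ip r (sr - v).
  rewrite -ler_pdivlMr // (le_trans _ leW) //.
  by rewrite -lee_fin fineK.
move: P0; set P := fine _ => P0 PW.
apply: le_trans (ler_wpM2l P0 rd_le) _.
apply: le_trans (ler_wpM2l P0 (ip_CauchySchwarz _ _)) _.
by rewrite mulrA mulrC ler_wpM2l ?ipnorm_ge0.
Qed.



End InnerProduct.

Theorem lemma6 (R : realType) (n : nat) (ip : {dot 'rV[R]_n for idfun})
    (D : set 'rV[R]_n) (f : 'rV[R]_n -> R) (mu : R) :
  polytope D ->
  convex_function [set: convex_lmodType 'rV[R]_n] f ->
  (forall x, differentiable f x) ->
  0 <= mu ->
  strongly_convex_on ip f mu D ->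
  (mu%:E * (pyramidal_width ip D) ^+ 2 <= muA ip f D)%E.
Proof.
move=> /(polytope_vertices ip)[s [us DE vE]] _ _ mu0 fmu; subst D.
set D := conv_hull _ in vE fmu *.
apply: le_ereal_inf_tmp => _ [x Dx <-].
apply: le_ereal_inf_tmp => _ [z [Dz gz] <-].
set g := grad ip f x in gz *; pose r := - g.
have rE y : ip r y = - ip g y by exact: linearNl.
have s_fP y : D y -> ip r y <= ip r (s_f ip f D x).
  have vertices0 : [set` s] !=set0 by exact: conv_hull_nonempty Dx.
  apply: conv_hull_ip_le => w ws; rewrite !rE lerN2.
  have [||_] := @argminP _ _ (ip g) (vertices ip D) s; rewrite ?vE //.
  by move=> /(_ w ws); rewrite /s_f vE.
have [S [AS vS vP]] : exists S : {fset 'rV[R]_n}, [/\ active_sets ip D x S,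
    v_f ip f D x \in S &
    forall w, w \in S -> ip r (v_f ip f D x) <= ip r w].
  have v_SP S : active_sets ip D x S ->
      v_S ip f S x \in S /\ forall w, w \in S -> ip g w <= ip g (v_S ip f S x).
    move=> [_ [a [_ a1 _]]]; apply: (@argmaxP _ _ (ip g) [set` S]).
    apply: (@seq_maximum _ _ _ _ S) => //.
    have [S0|[w wS]] := fset_0Vmem S; last by exists w.
    by move/eqP: a1; rewrite S0 big_nil eq_sym oner_eq0.
  have [||[S AS vfE] _] := @argminP _ _ (ip g)
      [set v_S ip f S x | S in active_sets ip D x] s.
  - move=> _ [S AS <-]; have [vS _] := v_SP S AS.
    by rewrite -vE; case: AS => Sv _; exact: Sv.
  - by have [S AS] := active_sets_nonempty us vE Dx; exists (v_S ip f S x), S.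
  have [vS vP] := v_SP S AS.
  exists S; rewrite /v_f -vfE; split=> // w wS.
  by rewrite !rE lerN2; exact: vP.
have rz : 0 < ip r (z - x) by rewrite rE oppr_gt0.
have [P -> [P0 PW]] := pyramidal_width_le Dx Dz rz s_fP AS vS vP.
rewrite -EFin_expe -EFinM lee_fin.
have := fmu x z Dx Dz; rewrite /gammaA -/g.
have -> : ip g (s_f ip f D x - v_f ip f D x) =
  - ip r (s_f ip f D x - v_f ip f D x) by rewrite rE opprK.
have -> : ip g (z - x) = - ip r (z - x) by rewrite rE opprK.
move: PW rz; set c := ip r (z - x); set W := ip r _; set N := ipnorm _ _.
set F := f z - f x - - c => PW c0 muF.
(* If the gap W vanishes, gammaA and its inverse are 0 by convention, and the
   slope bound forces the width to be 0 as well. *)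
have [W0|W0] := eqVneq W 0.
  have -> : P = 0.
    apply/le_anti; rewrite P0 andbT -(pmulr_lle0 _ c0).
    by rewrite (le_trans PW) // W0 mulr0.
  by rewrite W0 oppr0 invr0 mulr0 !expr0n /= invr0 !mulr0 mul0r.
have -> : 2 / (- c / - W) ^+ 2 * F = (W / c) ^+ 2 * (2 * F).
  rewrite invrN mulrNN -[in RHS](invf_div c W) exprVn; ring.
have PNW : P <= N * (W / c) by rewrite mulrA ler_pdivlMr.
have : mu * P ^+ 2 <= mu * (N * (W / c)) ^+ 2.
  by rewrite ler_wpM2l // lerXn2r ?nnegrE // (le_trans P0).
move=> /le_trans; apply; rewrite exprMn mulrA mulrC ler_wpM2l ?sqr_ge0 //.
lra.
Qed.
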